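(* For every rational $\epsilon>0$ there is a pure-integer corner relaxation $\mathcal{C}_\epsilon\subseteq\mathbb{R}^3$, i.e. $\mathcal{C}_\epsilon=\mathcal{C}(f,\emptyset,\{q^1,q^2\})$ for some $f\in[0,1]\setminus\mathbb{Z}$ and distinct rational numbers $q^1,q^2$, with variables $(x,y_1,y_2)$, whose split closure $\mathcal{SC}_\epsilon$ satisfies $$\frac{\min\{y_1+y_2:(x,y_1,y_2)\in\mathcal{C}_\epsilon\}}{\min\{y_1+y_2:(x,y_1,y_2)\in\mathcal{SC}_\epsilon\}}\ \ge\ \frac{1}{12\epsilon}.$$
   Context: For $f\in[0,1]\setminus\mathbb{Z}$ and distinct $q^1,q^2\in\mathbb{R}$, the pure-integer (one-row) corner relaxation $\mathcal{C}(f,\emptyset,\{q^1,q^2\})$ is the set of $(x,y_1,y_2)\in\mathbb{Z}^3$ with $y_1,y_2\ge0$ and $x=f+q^1y_1+q^2y_2$. Its linear relaxation $\mathcal{C}_{LP}$ is the set of $(x,y_1,y_2)\in\mathbb{R}^3$ with $y_1,y_2\ge0$ and $x=f+q^1y_1+q^2y_2$. A cut is a function $\pi:\{q^1,q^2\}\to[0,\infty)$, satisfied by $(x,y_1,y_2)$ if $\pi(q^1)y_1+\pi(q^2)y_2\ge1$. For $\alpha\in\mathbb{Z}$ with $\alpha f\notin\mathbb{Z}$ and $\beta_1,\beta_2\in\mathbb{Z}$, let $D(\alpha,\beta,f)=\{(x,y_1,y_2):\alpha x+\beta_1y_1+\beta_2y_2\le\lfloor\alpha f\rfloor\}\cup\{(x,y_1,y_2):\alpha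 x+\beta_1y_1+\beta_2y_2\ge\lceil\alpha f\rceil\}$. A split cut is a cut that, for some such $\alpha,\beta_1,\beta_2$, is satisfied by all points of $\mathcal{C}_{LP}\cap D(\alpha,\beta,f)$. The split closure is the set of all points of $\mathcal{C}_{LP}$ that satisfy all split cuts. *)

(* Defs.v *)
From mathcomp Require Import all_boot all_order all_algebra.
From mathcomp Require Import boolp classical_sets reals.

Set Implicit Arguments.
Unset Strict Implicit.
Unset Printing Implicit Defensive.

Import Order.TTheory GRing.Theory Num.Theory.
Local Open Scope classical_set_scope.
Local Open Scope ring_scope.

Section SplitClosure.
Variable R : realType.

(* Points (x, y1, y2) of R^3 are triples in R * R * R. *)

Definition corner_LP (f q1 q2 : R) : set (R * R * R) :=
  [set p | let: (x, y1, y2) := p in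
    [/\ 0 <= y1, 0 <= y2 & x = f + q1 * y1 + q2 * y2]].

Definition corner (f q1 q2 : R) : set (R * R * R) :=
  [set p | let: (x, y1, y2) := p in
    [/\ x \is a Num.int, y1 \is a Num.int, y2 \is a Num.int,
        0 <= y1 /\ 0 <= y2 & x = f + q1 * y1 + q2 * y2]].

(* A function {q1, q2} -> [0, +oo[ is represented by pi : R -> R, of which
   only the values at q1 and q2 are ever used. *)
Definition is_cut (q1 q2 : R) (pi : R -> R) : Prop := 0 <= pi q1 /\ 0 <= pi q2.

Definition cut_sat (q1 q2 : R) (pi : R -> R) : set (R * R * R) :=
  [set p | let: (_, y1, y2) := p in 1 <= pi q1 * y1 + pi q2 * y2].

Definition split_disj (alpha beta1 beta2 : int) (f : R) : set (R * R * R) :=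
  [set p | let: (x, y1, y2) := p in
    alpha%:~R * x + beta1%:~R * y1 + beta2%:~R * y2
      <= (Num.floor (alpha%:~R * f))%:~R] `|`
  [set p | let: (x, y1, y2) := p in
    (Num.ceil (alpha%:~R * f))%:~R
      <= alpha%:~R * x + beta1%:~R * y1 + beta2%:~R * y2].

Definition is_split_cut (f q1 q2 : R) (pi : R -> R) : Prop :=
  is_cut q1 q2 pi /\
  exists alpha beta1 beta2 : int,
    alpha%:~R * f \isn't a Num.int /\
    corner_LP f q1 q2 `&` split_disj alpha beta1 beta2 f
      `<=` cut_sat q1 q2 pi.

Definition split_closure (f q1 q2 : R) : set (R * R * R) :=
  corner_LP f q1 q2 `&`
  [set p | forall pi : R -> R, is_split_cut f q1 q2 pi -> cut_sat q1 q2 pi p].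

Definition sum_y (p : R * R * R) : R := let: (_, y1, y2) := p in y1 + y2.

(* m is the attained minimum of g over S; in particular S is nonempty. *)
Definition is_min_over (T : Type) (g : T -> R) (S : set T) (m : R) : Prop :=
  (g @` S) m /\ lbound (g @` S) m.

End SplitClosure.

(* Main.v *)
Require Import Defs.
From mathcomp Require Import all_boot all_order all_algebra.
From mathcomp Require Import boolp classical_sets reals.
From mathcomp Require Import zify ring lra.

Import Order.TTheory GRing.Theory Num.Theory.
Local Open Scope classical_set_scope.
Local Open Scope ring_scope.

(** For a positive integer [k], take [f = 1/2], [q1 = 1/(4k)] and
    [q2 = q1 + 1/2]. The minimum over the corner relaxation is [2k] while the
    minimum over the split closure is [2], so the ratio is [k], which can be
    made as large as desired.

    On the integer side, [x = f + q1 y1 + q2 y2] reads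
    [y1 + y2 = 2k (2x - y2 - 1)], so [y1 + y2] is a multiple of [2k]; it is
    nonzero because [y1 = y2 = 0] would give [x = 1/2] (lemma [corner_min]).

    On the split side, a multiplier [alpha] is admissible exactly when it is
    odd, and then [alpha f] lies halfway between two integers. On the linear
    relaxation the disjunction becomes [1/2 <= |r1 y1 + r2 y2|] with
    [ri = alpha qi + betai], so its strongest cut has coefficients [2 |ri|]
    (lemma [split_cut_halfE]). Even multipliers could make [r1] and [r2] small
    simultaneously, but they are excluded, and for odd [alpha] the number
    [r2 - r1 = alpha / 2 + beta2 - beta1] is half an odd integer. Hence
    [2 |r1| + 2 |r2| >= 1]: the point [y = (1, 1)] satisfies every split cut.
    Conversely, passing from [alpha = 1] to [alpha = 2k + 1] adds [1/2] modulo 1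
    to both [alpha q1] and [alpha q2], which exchanges the coefficients [1/(2k)]
    and [1 - 1/(2k)] of the cut; the two cuts add up to [y1 + y2 >= 2]
    (lemma [split_closure_min]). *)

Section HalfSplits.
Variable R : realType.
Implicit Types (q y r : R) (c b : int).

Lemma half_odd_norm_ge c : (1 / 2 : R) <= `|c%:~R + 1 / 2|.
Proof.
have [c0|c0] := leP 0 c.
  have : (0 : R) <= c%:~R by rewrite ler0z.
  by move=> h; rewrite ger0_norm; lra.
have : c%:~R <= (-1)%:~R :> R by rewrite ler_int; lia.
by rewrite rmorphN1 => h; rewrite ler0_norm; lra.
Qed.

Lemma half_notin_int : (1 / 2 : R) \isn't a Num.int.
Proof.
apply/negP => /intrP [z hz].
have : (1 : R) = (2 * z)%:~R by rewrite intrM; lra.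
rewrite -[LHS](mulr1z 1) => /intr_inj; lia.
Qed.

Lemma mul_half_notin_int (a : int) :
  a%:~R * (1 / 2 : R) \isn't a Num.int -> exists c, a = 2 * c + 1.
Proof.
move=> ha.
have ea : a = 2 * (a %/ 2)%Z + (a %% 2)%Z by lia.
have : (a %% 2)%Z = 0 \/ (a %% 2)%Z = 1 by lia.
case=> e; last by exists (a %/ 2)%Z; lia.
case/negP: ha; apply/intrP; exists (a %/ 2)%Z.
by rewrite {1}ea e addr0 intrM; lra.
Qed.

Lemma odd_half c : (2 * c + 1)%:~R * (1 / 2) = c%:~R + 1 / 2 :> R.
Proof. by rewrite intrD intrM; lra. Qed.

Lemma odd_half_notin_int c : (2 * c + 1)%:~R * (1 / 2 : R) \isn't a Num.int.
Proof. by rewrite odd_half rpredDl ?intr_int // half_notin_int. Qed.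

Lemma split_disj_halfE c b1 b2 q1 q2 y1 y2 :
  split_disj (2 * c + 1) b1 b2 (1 / 2) (1 / 2 + q1 * y1 + q2 * y2, y1, y2) <->
  1 / 2 <= `|((2 * c + 1)%:~R * q1 + b1%:~R) * y1
             + ((2 * c + 1)%:~R * q2 + b2%:~R) * y2|.
Proof.
have hf : Num.floor ((2 * c + 1)%:~R * (1 / 2) : R) = c.
  by apply: floor_def; rewrite odd_half intrD; lra.
have hc : Num.ceil ((2 * c + 1)%:~R * (1 / 2) : R) = c + 1.
  by apply: ceil_def; rewrite odd_half !intrD; lra.
have hh := odd_half c.
rewrite /split_disj /setU /= hf hc intrD ler_normr.
move: ((2 * c + 1)%:~R : R) hh => a hh.
split.
  by case=> h; apply/orP; [right|left]; lra.
by case/orP => h; [right|left]; lra.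
Qed.

(** The coefficient of [qi] is forced by the points of the [yi]-axis that lie on
    the boundary of the disjunction; [f = 1/2] makes the two sides of the split
    symmetric, so that a single absolute value covers both signs of [ri]. *)
Lemma split_cut_halfE q1 q2 (pi : R -> R) :
  is_split_cut (1 / 2) q1 q2 pi <->
  is_cut q1 q2 pi /\ exists c b1 b2,
    2 * `|(2 * c + 1)%:~R * q1 + b1%:~R| <= pi q1 /\
    2 * `|(2 * c + 1)%:~R * q2 + b2%:~R| <= pi q2.
Proof.
split=> [[[p1 p2] [a [b1 [b2 [ha hcut]]]]]|[[p1 p2] [c [b1 [b2 [h1 h2]]]]]].
  split=> //; have [c ec] := mul_half_notin_int a ha.
  rewrite {}ec {ha} in hcut; exists c, b1, b2.
  set r1 := _ + b1%:~R; set r2 := _ + b2%:~R.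
  have hsat y1 y2 : 0 <= y1 -> 0 <= y2 -> 1 / 2 <= `|r1 * y1 + r2 * y2| ->
      1 <= pi q1 * y1 + pi q2 * y2.
    move=> y10 y20 hr.
    apply: (hcut (1 / 2 + q1 * y1 + q2 * y2, y1, y2)); split=> //.
    exact/split_disj_halfE.
  have axis r : r != 0 -> `|r * (2 * `|r|)^-1| = 1 / 2.
    move=> r0; rewrite normrM normfV normrM normr_id (ger0_norm (ler0n _ 2)).
    by field; rewrite normr_eq0.
  have pos r : 0 <= (2 * `|r|)^-1 :> R by rewrite invr_ge0 mulr_ge0.
  split.
    have [->|r0] := eqVneq r1 0; first by rewrite normr0 mulr0.
    have := hsat (2 * `|r1|)^-1 0 (pos r1) (lexx _).
    rewrite !mulr0 !addr0 axis // lexx => /(_ isT).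
    by rewrite ler_pdivlMr ?mul1r // mulr_gt0 ?normr_gt0.
  have [->|r0] := eqVneq r2 0; first by rewrite normr0 mulr0.
  have := hsat 0 (2 * `|r2|)^-1 (lexx _) (pos r2).
  rewrite !mulr0 !add0r axis // lexx => /(_ isT).
  by rewrite ler_pdivlMr ?mul1r // mulr_gt0 ?normr_gt0.
split=> //; exists (2 * c + 1), b1, b2; split; first exact: odd_half_notin_int.
move=> [[x y1] y2] [/= [y10 y20 ->]] /split_disj_halfE hr.
move: h1 h2 hr; set r1 := _ + b1%:~R; set r2 := _ + b2%:~R => h1 h2 hr.
have := ler_normD (r1 * y1) (r2 * y2).
rewrite !normrM (ger0_norm y10) (ger0_norm y20) => ht.
have := ler_wpM2r y10 h1; have := ler_wpM2r y20 h2; lra.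
Qed.

Lemma corner_min (k : nat) : (0 < k)%N ->
  is_min_over (@sum_y R)
    (corner (1 / 2) (4 * k%:R)^-1 ((4 * k%:R)^-1 + 1 / 2)) (2 * k%:R).
Proof.
move=> k0; have k0' : (0 : R) < k%:R by rewrite ltr0n.
split.
  exists (1, 2 * k%:R, 0) => /=; last by rewrite addr0.
  split; rewrite ?rpred1 ?rpred0 ?rpredM ?rpred_nat //.
  - by split=> //; lra.
  - by field; rewrite lt0r_neq0.
move=> _ [[[x y1] y2] /= [/intrP [z ->] _ /intrP [w ->] [y10 y20] hx] <-].
have e : y1 + w%:~R = 2 * k%:R * (2 * z - w - 1)%:~R.
  rewrite !intrB intrM; move/(congr1 (fun t => 4 * k%:R * t)): hx.
  have -> : 4 * k%:R * (1 / 2 + (4 * k%:R)^-1 * y1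
              + ((4 * k%:R)^-1 + 1 / 2) * w%:~R)
            = 2 * k%:R + y1 + w%:~R + 2 * k%:R * w%:~R :> R.
    by field; rewrite lt0r_neq0.
  by move=> h; lra.
have pos : 0 < 2 * z - w - 1.
  have w0 : 0 <= w by rewrite -(ler0z R).
  rewrite lt_neqAle; apply/andP; split; last first.
    rewrite -(ler0z R) -(@pmulr_rge0 _ (2 * k%:R)) ?mulr_gt0 // -e.
    exact: addr_ge0.
  apply/eqP => n0; move: e; rewrite -n0 mulr0 => e.
  have : w%:~R = 0 :> R by lra.
  by move/eqP; rewrite intr_eq0 => /eqP; lia.
rewrite e ler_pMr ?mulr_gt0 //.
by rewrite -[X in X <= _](mulr1z 1) ler_int; lia.
Qed.

Lemma split_closure_min (k : nat) : (0 < k)%N ->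
  is_min_over (@sum_y R)
    (split_closure (1 / 2) (4 * k%:R)^-1 ((4 * k%:R)^-1 + 1 / 2)) 2.
Proof.
move=> k0; have k1 : (1 : R) <= k%:R by rewrite ler1n.
set q : R := (4 * k%:R)^-1.
have kq : k%:R * q = 1 / 4 by rewrite /q; field; rewrite lt0r_neq0 //; lra.
have q0 : 0 < q by rewrite invr_gt0; lra.
have q4 : q <= 1 / 4 by rewrite -kq ler_peMl // ltW.
split.
  exists (1 / 2 + q * 1 + (q + 1 / 2) * 1, 1, 1) => /=; last by [].
  split; first by split.
  move=> pi /split_cut_halfE [_ [c [b1 [b2 []]]]] /=; rewrite !mulr1.
  set r1 := _ + b1%:~R; set r2 := _ + b2%:~R => h1 h2.
  have e : r2 - r1 = (c + b2 - b1)%:~R + 1 / 2.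
    by rewrite /r1 /r2 !(intrB, intrD) intrM; lra.
  have := half_odd_norm_ge (c + b2 - b1); rewrite -e.
  by have := ler_normB r2 r1; lra.
move=> _ [[[x y1] y2] /= [[y10 y20 _] hcut] <-].
(* [1/2 - q] is [|q2 - 1|] for [alpha = 1] and [|(2k + 1) q1 - 1|] for
   [alpha = 2k + 1], with [2k q1 = 1/2]. *)
have neq : (q + 1 / 2 == q) = false by apply/negbTE/eqP; lra.
pose cut (a b t : R) := if t == q then a else b.
have cutE (a b : R) : cut a b q = a /\ cut a b (q + 1 / 2) = b.
  by rewrite /cut eqxx neq.
have [e1 e2] := cutE (2 * q) (1 - 2 * q).
have [e3 e4] := cutE (1 - 2 * q) (2 * q).
have near : `|q - 1 / 2| = 1 / 2 - q by rewrite ler0_norm; lra.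
have nq : `|q| = q by rewrite gtr0_norm.
have s1 : is_split_cut (1 / 2) q (q + 1 / 2) (cut (2 * q) (1 - 2 * q)).
  apply/split_cut_halfE; rewrite /is_cut e1 e2; split; first by split; lra.
  exists 0, 0, (-1).
  have -> : (2 * 0 + 1)%:~R * q + 0%:~R = q by rewrite /=; lra.
  have -> : (2 * 0 + 1)%:~R * (q + 1 / 2) + (-1)%:~R = q - 1 / 2.
    by rewrite intrN /=; lra.
  by rewrite nq near; split; lra.
have s2 : is_split_cut (1 / 2) q (q + 1 / 2) (cut (1 - 2 * q) (2 * q)).
  apply/split_cut_halfE; rewrite /is_cut e3 e4; split; first by split; lra.
  exists k%:Z, (-1), (- (k%:Z + 1)).
  have hk : (2 * k%:Z + 1)%:~R = 2 * k%:R + 1 :> R.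
    by rewrite intrD intrM.
  have -> : (2 * k%:Z + 1)%:~R * q + (-1)%:~R = q - 1 / 2.
    by rewrite hk intrN; lra.
  have -> : (2 * k%:Z + 1)%:~R * (q + 1 / 2) + (- (k%:Z + 1))%:~R = q.
    by rewrite hk intrN intrD -pmulrn; lra.
  by rewrite nq near; split; lra.
have /= := hcut _ s1; have /= := hcut _ s2; rewrite e1 e2 e3 e4; lra.
Qed.

End HalfSplits.

Theorem theorem3 (R : realType) (eps : rat) (heps : 0 < eps) :
  exists (f : R) (q1 q2 : rat),
    [/\ 0 <= f <= 1, f \isn't a Num.int, q1 != q2 &
      exists m M : R,
        [/\ is_min_over (@sum_y R) (corner f (ratr q1) (ratr q2)) m,
            is_min_over (@sum_y R) (split_closure f (ratr q1) (ratr q2)) M,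
            0 < M &
            1 / (12%:R * ratr eps) <= m / M]].
Proof.
have e0 : (0 : R) < 12%:R * ratr eps by rewrite mulr_gt0 // ltr0q.
set t : R := 1 / (12%:R * ratr eps).
have t0 : 0 < t by rewrite divr_gt0.
have tk := archi_boundP (ltW t0).
set k := Num.bound t in tk.
have k0 : (0 < k)%N by rewrite -(ltr0n R); apply: lt_trans tk.
exists (1 / 2), (4 * k%:R)^-1, ((4 * k%:R)^-1 + 1 / 2); split.
- by apply/andP; split; lra.
- exact: half_notin_int.
- by apply/eqP; lra.
have r1 : ratr (4 * k%:R)^-1 = (4 * k%:R)^-1 :> R.
  by rewrite fmorphV rmorphM /= !ratr_nat.
have r2 : ratr ((4 * k%:R)^-1 + 1 / 2) = (4 * k%:R)^-1 + 1 / 2 :> R.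
  by rewrite rmorphD /= r1 !div1r fmorphV /= ratr_nat.
exists (2 * k%:R), 2; rewrite r1 r2; split.
- exact: corner_min.
- exact: split_closure_min.
- by [].
- by rewrite mulrAC divff ?mul1r ?ltW // pnatr_eq0.
Qed.
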